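(* Let $m\ge 3$ be an integer. Let $(y_{ij})_{1\le i,j\le m}$ be an $m\times m$ real skew-symmetric data matrix following the model $$y_{ij}=\mu_{ij}+\varepsilon_{ij},\qquad \mu_{ij}=(\alpha_i-\alpha_j)+\lambda(c_id_j-d_ic_j),\quad \lambda\ge 0,\quad 1\le i,j\le m,$$ where $\varepsilon_{ij}$ $(i<j)$ are independent with the normal distribution $N(0,\sigma^2)$, $\varepsilon_{ji}=-\varepsilon_{ij}$, $\varepsilon_{ii}=0$, and the unknown parameters are $\sigma^2>0$, $\lambda\ge0$, real $\alpha_1,\dots,\alpha_m$ with $\sum_i\alpha_i=0$, and real $c_1,\dots,c_m,d_1,\dots,d_m$ satisfying $$\sum_ic_i^2=\sum_id_i^2=1,\qquad \sum_ic_i=\sum_id_i=\sum_ic_id_i=0.$$ Let $\widehat\alpha_i=\sum_{j=1}^m y_{ij}/m$, $\widehat\gamma_{ij}=y_{ij}-(\widehat\alpha_i-\widehat\alpha_j)$ and $\widehat\Gamma=(\widehat\gamma_{ij})_{1\le i,j\le m}$. Then the likelihood ratio test statistic for testing the hypothesis $\lambda=0$ (against $\lambda\ge0$ unrestricted) is $$\frac{\sigma_1(\widehat\Gamma)}{\sqrt{\sum_{i=1}^{[(m-1)/2]}\sigma_i^2(\widehat\Gamma)}}=\frac{\sigma_1(\widehat\Gamma)}{\sqrt{\mathrm{tr}(\widehat\Gamma'\widehat\Gamma)/2}},$$ the standardized largest singular value of $\widehat\Gamma$.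
   Context: $[\cdot]$ denotes the integer part and $'$ transpose. The singular values of an $m\times m$ real skew-symmetric matrix $B$ are the numbers $\sigma_1(B)\ge\sigma_2(B)\ge\cdots\ge\sigma_{[m/2]}(B)\ge0$ in a decomposition $B=\sum_{i=1}^{[m/2]}\sigma_i(B)(u_{2i-1}u_{2i}'-u_{2i}u_{2i-1}')$ with $u_i$ the $i$th column of an $m\times m$ orthogonal matrix (each is listed once, although it occurs twice in the usual list of singular values). The likelihood of the data is the joint density of $(y_{ij})_{i<j}$. The likelihood ratio is $\Lambda=\sup_{\lambda=0}L/\sup L$, where the numerator is the supremum of the likelihood over all parameters with $\lambda=0$ and the denominator is the supremum over all parameters of the model (with $\Lambda=0$ if the denominator is $+\infty$). As usual, a statistic $T$ is said to be the likelihood ratio test statistic if $\Lambda$ is a strictly decreasing function of $T$, so that the likelihood ratio test rejects for large values of $T$. Data with $\widehat\Gamma=0$, which occur with probability zero, are excluded. *)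

(* Defs.v *)
(* MathComp-Analysis, over an arbitrary [R : realType]. *)
From HB Require Import structures.
From mathcomp Require Import all_boot all_order all_algebra.
From mathcomp Require Import all_classical all_reals all_analysis.

Set Implicit Arguments.
Unset Strict Implicit.
Unset Printing Implicit Defensive.

Import Order.TTheory GRing.Theory Num.Theory.
Local Open Scope classical_set_scope.
Local Open Scope ring_scope.

Definition skew_mx (R : realType) (m : nat) (B : 'M[R]_m) : Prop :=
  B^T = - B.

Lemma ltn_pair2 (m : nat) (i : 'I_m./2) : (i.*2.+1 < m)%N.
Proof. by rewrite -gtn_half_double ltn_ord. Qed.

(* 0-based: columns 2i and 2i+1 here are u_{2i-1} and u_{2i} in 1-based
   notation. *)
Definition pair1 (m : nat) (i : 'I_m./2) : 'I_m := Ordinal (ltnW (ltn_pair2 i)).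
Definition pair2 (m : nat) (i : 'I_m./2) : 'I_m := Ordinal (ltn_pair2 i).

(* [s] lists sigma_1, ..., sigma_[m/2], so that sigma_(i+1) is [s`_i]; each
   singular value is listed once, not with its double multiplicity. *)
Definition is_skew_singular_values (R : realType) (m : nat)
    (B : 'M[R]_m) (s : seq R) : Prop :=
  [/\ size s = m./2,
      sorted >=%R s,
      all (>= 0) s &
      exists2 U : 'M[R]_m, U^T *m U = 1%:M &
        B = \sum_(i < m./2) s`_i *:
              (col (pair1 i) U *m (col (pair2 i) U)^T
               - col (pair2 i) U *m (col (pair1 i) U)^T)].

(* The default [::] is irrelevant for skew-symmetric B, which always have
   such a decomposition, with a unique s. *)
Definition skew_singular_values (R : realType) (m : nat) (B : 'M[R]_m) : seq R :=
  xget [::] [set s | is_skew_singular_values B s].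

Record params (R : realType) (m : nat) := Params {
  sigma2 : R;
  lam : R;
  alpha : 'I_m -> R;
  cvec : 'I_m -> R;
  dvec : 'I_m -> R }.

Definition param_space (R : realType) (m : nat) : set (params R m) :=
  [set p | [/\ 0 < sigma2 p, 0 <= lam p & \sum_i alpha p i = 0] /\
           [/\ \sum_i cvec p i ^+ 2 = 1, \sum_i dvec p i ^+ 2 = 1,
               \sum_i cvec p i = 0, \sum_i dvec p i = 0 &
               \sum_i cvec p i * dvec p i = 0]].

Definition null_space (R : realType) (m : nat) : set (params R m) :=
  @param_space R m `&` [set p | lam p = 0].

Definition mu (R : realType) (m : nat) (p : params R m) (i j : 'I_m) : R :=
  (alpha p i - alpha p j)
  + lam p * (cvec p i * dvec p j - dvec p i * cvec p j).

(* Joint density of the independent y_ij ~ N(mu p i j, sigma2 p), i < j;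
   the second argument of [normal_pdf] is the standard deviation. *)
Definition likelihood (R : realType) (m : nat) (y : 'M[R]_m) (p : params R m) : R :=
  \prod_(i < m) \prod_(j < m | (i < j)%N)
    normal_pdf (mu p i j) (Num.sqrt (sigma2 p)) (y i j).

Definition sup_likelihood (R : realType) (m : nat) (y : 'M[R]_m)
    (P : set (params R m)) : \bar R :=
  ereal_sup [set (likelihood y p)%:E | p in P].

Definition likelihood_ratio (R : realType) (m : nat) (y : 'M[R]_m) : R :=
  if sup_likelihood y (@param_space R m) == +oo%E then 0
  else fine (sup_likelihood y (@null_space R m))
       / fine (sup_likelihood y (@param_space R m)).

Definition alpha_hat (R : realType) (m : nat) (y : 'M[R]_m) (i : 'I_m) : R :=
  (\sum_j y i j) / m%:R.

Definition Gamma_hat (R : realType) (m : nat) (y : 'M[R]_m) : 'M[R]_m :=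
  \matrix_(i, j) (y i j - (alpha_hat y i - alpha_hat y j)).

Definition data_space (R : realType) (m : nat) : set 'M[R]_m :=
  [set y | skew_mx y /\ Gamma_hat y != 0].

(* The likelihood ratio is a strictly decreasing function g of T; g only
   matters on the set of values taken by T. *)
Definition is_LRT_statistic (R : realType) (m : nat) (T : 'M[R]_m -> R) : Prop :=
  exists g : R -> R,
    (forall a b, (T @` @data_space R m) a -> (T @` @data_space R m) b ->
       a < b -> g b < g a) /\
    (forall y, data_space y -> likelihood_ratio y = g (T y)).

(* Main.v *)
(* Since the matrices [(a_i - a_j)] are orthogonal to the skew-symmetric
   matrices with zero row sums, the residual sum of squares over i < j is
     S - 2 lam c' Gamma d + lam^2 + (sum of squares in alpha_hat - alpha),
   where S = tr(Gamma' Gamma) / 2 is the sum of the squared singular values.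
   As c' Gamma d <= sigma_1, with equality at the leading pair of singular
   vectors (orthogonal to the vector of ones, which Gamma kills), its minimum
   is S when lam = 0 and S - sigma_1^2 in general. Maximizing over sigma^2 then
   gives Lambda = (1 - T^2)^(N/2), with N = m(m-1)/2 and T = sigma_1 / sqrt S;
   this remains true when S = sigma_1^2, where the likelihood is unbounded.
   Singular values exist by induction on the dimension: a maximizer d of
   |B d| on the unit sphere and c = B d / |B d| span an invariant plane. *)
Require Import Defs.
From HB Require Import structures.
From mathcomp Require Import all_boot all_order all_algebra.
From mathcomp Require Import all_classical all_reals all_analysis.
From mathcomp Require Import ring lra.

Import Order.TTheory GRing.Theory Num.Theory.
Import numFieldNormedType.Exports.
Local Open Scope classical_set_scope.
Local Open Scope ring_scope.

(** * Euclidean geometry and skew-symmetric normal form *)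

Section Dot.
Context {R : realType}.

Definition dot {n} (u v : 'cV[R]_n) : R := (u^T *m v) 0 0.

Lemma dotE {n} (u v : 'cV[R]_n) : dot u v = \sum_i u i 0 * v i 0.
Proof. by rewrite /dot mxE; apply: eq_bigr => i _; rewrite mxE. Qed.

Lemma dotC {n} (u v : 'cV[R]_n) : dot u v = dot v u.
Proof. by rewrite !dotE; apply: eq_bigr => i _; rewrite mulrC. Qed.

Lemma dotDr {n} (u v w : 'cV[R]_n) : dot u (v + w) = dot u v + dot u w.
Proof. by rewrite /dot mulmxDr mxE. Qed.

Lemma dotZr {n} a (u v : 'cV[R]_n) : dot u (a *: v) = a * dot u v.
Proof. by rewrite /dot -scalemxAr mxE. Qed.

Lemma dotNr {n} (u v : 'cV[R]_n) : dot u (- v) = - dot u v.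
Proof. by rewrite -scaleN1r dotZr mulN1r. Qed.

Lemma dotDl {n} (u v w : 'cV[R]_n) : dot (u + v) w = dot u w + dot v w.
Proof. by rewrite dotC dotDr (dotC w u) (dotC w v). Qed.

Lemma dotZl {n} a (u v : 'cV[R]_n) : dot (a *: u) v = a * dot u v.
Proof. by rewrite dotC dotZr dotC. Qed.

Lemma dotNl {n} (u v : 'cV[R]_n) : dot (- u) v = - dot u v.
Proof. by rewrite dotC dotNr dotC. Qed.

Lemma dot_mulr {n p} (A : 'M[R]_(n, p)) u v : dot u (A *m v) = dot (A^T *m u) v.
Proof. by rewrite /dot trmx_mul trmxK mulmxA. Qed.

Lemma dot_ge0 {n} (u : 'cV[R]_n) : 0 <= dot u u.
Proof. by rewrite dotE; apply: sumr_ge0 => i _; rewrite -expr2 sqr_ge0. Qed.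

Lemma dot_eq0 {n} (u : 'cV[R]_n) : dot u u = 0 -> u = 0.
Proof.
rewrite dotE => /eqP; rewrite psumr_eq0; last by move=> i _; rewrite -expr2 sqr_ge0.
move=> /allP u0; apply/colP => i; rewrite mxE.
by have := u0 i (mem_index_enum i); rewrite mulf_eq0 orbb => /eqP.
Qed.

Lemma dot_skew {n} (B : 'M[R]_n) u v : skew_mx B -> dot u (B *m v) = - dot v (B *m u).
Proof. by move=> sB; rewrite dot_mulr sB mulNmx dotNl dotC. Qed.

Lemma dot_skew0 {n} (B : 'M[R]_n) u : skew_mx B -> dot u (B *m u) = 0.
Proof. by move=> sB; have := dot_skew B u u sB; lra. Qed.

Lemma dot_orth {n} {U : 'M[R]_n} {u v} : U^T *m U = 1%:M -> dot (U *m u) (U *m v) = dot u v.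
Proof. by move=> oU; rewrite dot_mulr mulmxA oU mul1mx. Qed.

Lemma mulmx_cV_inj {n p} (A B : 'M[R]_(n, p)) :
  (forall v : 'cV_p, A *m v = B *m v) -> A = B.
Proof.
move=> AB; apply/matrixP => i j.
by have /colP/(_ i) := AB (delta_mx j 0); rewrite -!colE !mxE.
Qed.

(* Householder reflection in the hyperplane orthogonal to [x - y]. *)
Lemma reflection_exists {n} (x y : 'cV[R]_n) : dot x x = dot y y ->
  exists H : 'M[R]_n, [/\ H^T *m H = 1%:M, H *m x = y &
    forall z, dot z x = dot z y -> H *m z = z].
Proof.
move=> xy; have [->|xNy] := eqVneq x y.
  by exists 1%:M; split => [||z _]; rewrite ?trmx1 mul1mx.
set v := x - y; set c := dot v v.
have c0 : c != 0.
  by apply/eqP => /dot_eq0/eqP; rewrite subr_eq0 (negbTE xNy).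
set H := 1%:M - (2 / c) *: (v *m v^T).
have HE z : H *m z = z - (2 / c * dot v z) *: v.
  rewrite mulmxBl mul1mx -scalemxAl -mulmxA -scalerA.
  by rewrite [v^T *m z]mx11_scalar mul_mx_scalar.
exists H; split.
- apply: mulmx_cV_inj => z; rewrite mul1mx -mulmxA.
  have -> : H^T = H.
    by rewrite /H linearB /= linearZ /= trmx_mul trmxK trmx1.
  rewrite !HE dotDr dotNr dotZr -/c -addrA -opprD -scalerDl.
  suff -> : 2 / c * dot v z + 2 / c * (dot v z - 2 / c * dot v z * c) = 0.
    by rewrite scale0r subr0.
  by field.
- have -> : H *m x = x - v.
    rewrite HE; have -> : 2 / c * dot v x = 1; last by rewrite scale1r.
    (* As [x] and [y] have equal norms, |x - y|^2 = 2 <x - y, x>. *)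
    suff -> : dot v x = c / 2 by field.
    rewrite /c /v !dotDr !dotDl !dotNr !dotNl xy (dotC y x); lra.
  by rewrite /v subKr.
- move=> z zxy; rewrite HE dotC dotDr dotNr zxy subrr mulr0 scale0r subr0 //.
Qed.

Lemma dot_delta {n} (i : 'I_n) (v : 'cV[R]_n) : dot (delta_mx i 0) v = v i 0.
Proof.
rewrite dotE (bigD1 i) //= big1 => [|j /negbTE ji]; rewrite !mxE ?eqxx ?mul1r ?addr0 //.
by rewrite ji mul0r.
Qed.

(** A product of two reflections. [A] takes the i-th basis vector to [c]; [H] takes the j-th to
    [d' = A^T d] and fixes the i-th, which is orthogonal to both the j-th and [d']. *)
Lemma orth_extend2 {n} (i j : 'I_n) (c d : 'cV[R]_n) : i != j ->
  dot c c = 1 -> dot d d = 1 -> dot c d = 0 ->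
  exists V : 'M[R]_n, [/\ V^T *m V = 1%:M,
    V *m delta_mx i 0 = c & V *m delta_mx j 0 = d].
Proof.
move=> ij cc dd cd.
have de k l : dot (delta_mx k 0 : 'cV[R]_n) (delta_mx l 0) = (k == l)%:R.
  by rewrite dot_delta mxE andbT.
have [|A [oA Ai _]] := @reflection_exists n (delta_mx i 0) c.
  by rewrite de eqxx cc.
have oA' : A *m A^T = 1%:M by apply: mulmx1C.
set d' := A^T *m d.
have dE : d = A *m d' by rewrite mulmxA oA' mul1mx.
have [|H [oH Hj Hfix]] := @reflection_exists n (delta_mx j 0) d'.
  by rewrite de eqxx -(dot_orth oA) -dE dd.
exists (A *m H); split.
- by rewrite trmx_mul mulmxA -(mulmxA H^T) oA mulmx1.
- rewrite -mulmxA Hfix // de (negbTE ij).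
  by rewrite -(dot_orth oA) Ai -dE cd.
- by rewrite -mulmxA Hj -dE.
Qed.

(** * Maximizing |A v| on the unit sphere, and the top pair of a skew-symmetric matrix *)

Lemma sphere_max {n} (A : 'M[R]_n.+1) : exists d : 'cV[R]_n.+1, dot d d = 1 /\
  forall v, dot v v = 1 -> dot (A *m v) (A *m v) <= dot (A *m d) (A *m d).
Proof.
(* Row vectors are used because [rV_compact] and [EVT_max_rV] are about them. *)
pose f (v : 'rV[R]_n.+1) : R := dot (A *m v^T) (A *m v^T).
pose nm (v : 'rV[R]_n.+1) : R := dot v^T v^T.
have cM p (M : 'M[R]_(p, n.+1)) :
    continuous (fun v : 'rV[R]_n.+1 => dot (M *m v^T) (M *m v^T) : R).
  move=> v.
  under eq_fun do rewrite dotE.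
  apply: (@cvg_big R _ +%R 0 xpredT add_continuous _ (nbhs v)) => i _.
  have ci : (fun v : 'rV[R]_n.+1 => (M *m v^T) i 0) @ v --> (M *m v^T) i 0.
    under eq_fun do rewrite mxE.
    rewrite mxE; apply: (@cvg_big R _ +%R 0 xpredT add_continuous _ (nbhs v)) => j _.
    apply: cvgM; first exact: cvg_cst.
    under eq_fun do rewrite mxE.
    rewrite mxE; exact: coord_continuous.
  exact: cvgM.
have cn : continuous nm.
  rewrite (_ : nm = fun v => dot (1%:M *m v^T) (1%:M *m v^T)); first exact: cM.
  by apply/funext => v; rewrite mul1mx.
pose S := [set v : 'rV[R]_n.+1 | nm v = 1].
have S0 : S !=set0.
  exists (delta_mx 0 0); rewrite /S /nm /= trmx_delta dot_delta mxE.
  by rewrite !eqxx.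
(* The sphere is a closed subset of the cube with sides [-1, 1]. *)
have cS : compact S.
  apply: (@subclosed_compact _ _
    [set v : 'rV[R]_n.+1 | forall i, `[(-1 : R), 1]%classic (v ord0 i)]).
  - have -> : S = nm @^-1` [set 1] by [].
    by apply: closed_comp; [move=> x _; exact: cn | exact: closed_eq].
  - apply: (@rV_compact R n.+1 (fun=> `[(-1 : R), 1]%classic)).
    by move=> _; exact: segment_compact.
  - move=> v; rewrite /S /nm /= dotE => v1 i.
    rewrite /= in_itv /= -ler_norml -(@ler_pXn2r _ 2) ?nnegrE //.
    rewrite expr1n -v1 (bigD1 i) //= !mxE -expr2 real_normK ?num_real //.
    by rewrite lerDl; apply: sumr_ge0 => j _; rewrite -expr2 sqr_ge0.
have [|d dS dmax] := EVT_max_rV S0 cS (f := f).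
  by apply: continuous_subspaceT; exact: cM.
exists d^T; split; first by move/set_mem: dS.
move=> v v1; have := dmax v^T; rewrite /f trmxK; apply.
by apply/mem_set; rewrite /S /nm /= trmxK.
Qed.

Lemma op_norm_attained {n} (A : 'M[R]_n.+1) : exists d : 'cV[R]_n.+1, dot d d = 1 /\
  forall v, dot (A *m v) (A *m v) <= dot (A *m d) (A *m d) * dot v v.
Proof.
have [d [d1 dmax]] := sphere_max A; exists d; split=> // v.
have [->|v0] := eqVneq v 0.
  by rewrite mulmx0 -(scale0r 0) !dotZr !mul0r mulr0.
have vv : 0 < dot v v.
  by rewrite lt_def dot_ge0 andbT; apply: contra v0 => /eqP/dot_eq0 ->.
set q := Num.sqrt (dot v v).
have q0 : q != 0 by rewrite gt_eqF // sqrtr_gt0.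
have qq : q ^+ 2 = dot v v by rewrite sqr_sqrtr // ltW.
have := dmax (q^-1 *: v); rewrite -scalemxAr !dotZl !dotZr -qq => /(_ _).
have -> : q^-1 * (q^-1 * q ^+ 2) = 1 by field.
move=> /(_ erefl); rewrite mulrA -expr2 exprVn mulrC ler_pdivrMr //.
by rewrite qq.
Qed.

Lemma skew_top_pair {n} (B : 'M[R]_n.+2) : skew_mx B ->
  exists t : R, exists c : 'cV[R]_n.+2, exists d : 'cV[R]_n.+2, [/\ 0 <= t,
    [/\ dot c c = 1, dot d d = 1 & dot c d = 0],
    B *m d = t *: c, B *m c = - t *: d &
    forall v, dot (B *m v) (B *m v) <= t ^+ 2 * dot v v].
Proof.
move=> sB; have [d [d1 dmax]] := op_norm_attained B.
set t2 := dot (B *m d) (B *m d) in dmax; set t := Num.sqrt t2.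
have tt : t ^+ 2 = t2 by rewrite sqr_sqrtr // dot_ge0.
(* A zero maximum forces [B = 0], and then any orthonormal pair serves. *)
have [t0|t0] := eqVneq t2 0.
  have B0 : B = 0.
    apply: mulmx_cV_inj => v; rewrite mul0mx; apply: dot_eq0.
    by apply/eqP; rewrite eq_le dot_ge0 andbT; have := dmax v; rewrite t0 mul0r.
  exists 0, (delta_mx 0 0), (delta_mx 1 0); rewrite B0; split=> //.
  - by rewrite !dot_delta !mxE.
  - by rewrite mul0mx scale0r.
  - by rewrite mul0mx oppr0 scale0r.
  - by move=> v; rewrite mul0mx -(scale0r 0) dotZr !mul0r expr0n mul0r.
have tgt : 0 < t by rewrite sqrtr_gt0 lt_def t0 dot_ge0.
pose c := t^-1 *: (B *m d).
have Bd : B *m d = t *: c by rewrite scalerA mulfV ?scale1r // gt_eqF.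
have c1 : dot c c = 1 by rewrite dotZl dotZr -/t2 -tt; field; rewrite gt_eqF.
have cd : dot c d = 0 by rewrite dotC dotZr dot_skew0 // mulr0.
have dBc : dot d (B *m c) = - t.
  by rewrite dot_skew // Bd dotZr c1 mulr1.
exists t, c, d; split; rewrite ?tt //; first exact: ltW.
(* Since <d, B c> = - t, the square |B c + t d|^2 expands to |B c|^2 - t^2, which is at most 0 by
   maximality of t. *)
apply/eqP; rewrite -subr_eq0; apply/eqP/dot_eq0/eqP.
rewrite eq_le dot_ge0 andbT scaleNr opprK.
rewrite !dotDr !dotDl !dotZl !dotZr (dotC (B *m c)) dBc d1.
by have := dmax c; rewrite c1 -tt; lra.
Qed.

(** * Canonical form attached to singular values and an orthogonal matrix *)

Lemma dot_sumr {n} (I : Type) (r : seq I) (P : pred I) (F : I -> 'cV[R]_n) u :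
  dot u (\sum_(i <- r | P i) F i) = \sum_(i <- r | P i) dot u (F i).
Proof. by rewrite /dot mulmx_sumr summxE. Qed.

Lemma dot_mull {n p} (A : 'M[R]_(n, p)) u v : dot (A *m u) v = dot u (A^T *m v).
Proof. by rewrite dot_mulr trmxK. Qed.

Lemma mxtrace_outer {n} (u v : 'cV[R]_n) : \tr (u *m v^T) = dot u v.
Proof. by rewrite mxtrace_mulC trace_mx11 dotC. Qed.

Definition pair_sum {n} (s : seq R) (U : 'M[R]_n) : 'M[R]_n :=
  \sum_(i < n./2) s`_i *: (col (pair1 i) U *m (col (pair2 i) U)^T
                           - col (pair2 i) U *m (col (pair1 i) U)^T).

Lemma dot_col_orth {n} {U : 'M[R]_n} i j : U^T *m U = 1%:M ->
  dot (col i U) (col j U) = (i == j)%:R.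
Proof. by move=> oU; rewrite !colE (dot_orth oU) dot_delta mxE andbT. Qed.

Lemma pair12_eq {n} (i j : 'I_n./2) :
  [/\ (pair1 i == pair1 j) = (i == j), (pair2 i == pair2 j) = (i == j),
      (pair1 i == pair2 j) = false & (pair2 i == pair1 j) = false].
Proof.
rewrite -!val_eqE /= eqSS (inj_eq double_inj).
split=> //; apply/negP => /eqP/(congr1 odd); by rewrite /= !odd_double.
Qed.

Lemma outer_mul_dot {n} (u v w : 'cV[R]_n) : u *m v^T *m w = dot v w *: u.
Proof. by rewrite -mulmxA [v^T *m w]mx11_scalar mul_mx_scalar. Qed.

Lemma pair_sum_mul {n} s (U : 'M[R]_n) v : pair_sum s U *m v =
  \sum_(i < n./2) s`_i *: (dot (col (pair2 i) U) v *: col (pair1 i) U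
                           - dot (col (pair1 i) U) v *: col (pair2 i) U).
Proof.
rewrite mulmx_suml; apply: eq_bigr => i _.
by rewrite -scalemxAl mulmxBl !outer_mul_dot.
Qed.

Lemma pair_sum_pair2 {n} s (U : 'M[R]_n) i : U^T *m U = 1%:M ->
  pair_sum s U *m col (pair2 i) U = s`_i *: col (pair1 i) U.
Proof.
move=> oU; rewrite pair_sum_mul (bigD1 i) //= big1 => [|j /negbTE ji].
  rewrite !(dot_col_orth _ _ oU); have [_ -> -> _] := pair12_eq i i.
  by rewrite eqxx scale1r scale0r subr0 addr0.
rewrite !(dot_col_orth _ _ oU); have [_ -> -> _] := pair12_eq j i.
by rewrite ji !scale0r subr0 scaler0.
Qed.

Lemma pair_sum_pair1 {n} s (U : 'M[R]_n) i : U^T *m U = 1%:M ->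
  pair_sum s U *m col (pair1 i) U = - s`_i *: col (pair2 i) U.
Proof.
move=> oU; rewrite pair_sum_mul (bigD1 i) //= big1 => [|j /negbTE ji].
  rewrite !(dot_col_orth _ _ oU); have [-> _ _ ->] := pair12_eq i i.
  by rewrite eqxx scale1r scale0r sub0r addr0 scalerN scaleNr.
rewrite !(dot_col_orth _ _ oU); have [-> _ _ ->] := pair12_eq j i.
by rewrite ji !scale0r subr0 scaler0.
Qed.

Lemma pair_sum_conj {n} s (V U : 'M[R]_n) :
  pair_sum s (V *m U) = V *m pair_sum s U *m V^T.
Proof.
rewrite mulmx_sumr mulmx_suml; apply: eq_bigr => i _.
rewrite -scalemxAr -scalemxAl mulmxBr mulmxBl !colE !trmx_mul.
by rewrite !mulmxA.
Qed.

(** The inductive step of the normal form: [(2 + n)./2] computes to [(n./2).+1], the first pair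
    gives the new 2 x 2 block, and every later pair is an old one shifted by two indices. *)
Lemma pair_sum_block {n} t s (U : 'M[R]_n) :
  pair_sum (n := 2 + n) (t :: s) (block_mx 1%:M 0 0 U) =
  block_mx (t *: (delta_mx 0 1 - delta_mx 1 0)) 0 0 (pair_sum s U).
Proof.
rewrite /pair_sum [LHS]big_ord_recl /=.
set W : 'M[R]_(2 + n) := block_mx _ _ _ _.
have Wl (i : 'I_2) : col (lshift n i) W = col_mx (delta_mx i 0) 0.
  by rewrite /W block_mxEh colKl colE mul_col_mx mul1mx mul0mx.
have Wr (i : 'I_n) : col (rshift 2 i) W = col_mx 0 (col i U).
  by rewrite /W block_mxEh colKr colE mul_col_mx mul0mx -colE.
rewrite (_ : @pair1 (2 + n) (ord0 : 'I_(n./2).+1) = lshift n (0 : 'I_2)); last exact: val_inj.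
rewrite (_ : @pair2 (2 + n) (ord0 : 'I_(n./2).+1) = lshift n (1 : 'I_2)); last exact: val_inj.
rewrite !Wl.
have r1 (i : 'I_n./2) : @pair1 (2 + n) (lift ord0 i : 'I_(n./2).+1) = rshift 2 (pair1 i).
  exact: val_inj.
have r2 (i : 'I_n./2) : @pair2 (2 + n) (lift ord0 i : 'I_(n./2).+1) = rshift 2 (pair2 i).
  exact: val_inj.
transitivity (block_mx (t *: (delta_mx 0 1 - delta_mx 1 0)) 0 0 (0 : 'M[R]_n)
   + \sum_(i < n./2) s`_i *: block_mx (0 : 'M[R]_2) 0 0
      (col (pair1 i) U *m (col (pair2 i) U)^T
       - col (pair2 i) U *m (col (pair1 i) U)^T)).
  congr (_ + _).
    rewrite !tr_col_mx !mul_col_row !trmx0 !mulmx0 !mul0mx opp_block_mx add_block_mx.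
    by rewrite scale_block_mx !trmx_delta !mul_delta_mx !subr0 !scaler0.
  apply: eq_bigr => i _; rewrite r1 r2 !Wr.
  rewrite !tr_col_mx !mul_col_row !trmx0 !mulmx0 !mul0mx opp_block_mx add_block_mx.
  by rewrite !subr0.
elim/big_rec2: _ => [|i A B _]; first by rewrite addr0.
move=> IH; rewrite addrCA IH scale_block_mx add_block_mx !scaler0 !add0r //.
Qed.

(** Strong induction on the dimension, removing two dimensions at a time. In an orthonormal basis
    starting with the top pair, [B] is block diagonal, and the induction hypothesis applies to the
    lower block [B']. *)
Lemma skew_singular_values_exists {n} (B : 'M[R]_n) : skew_mx B ->
  exists s, is_skew_singular_values B s.
Proof.
have [k] := ubnP n; elim: k => // k IH in n B *; case: n B => [|[|n]] B.
- move=> _ _; exists [::]; split=> //; exists 1%:M; rewrite ?trmx1 ?mul1mx //.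
  by rewrite big_ord0 [B]flatmx0.
- move=> _ sB; exists [::]; split=> //; exists 1%:M; rewrite ?trmx1 ?mul1mx //.
  rewrite big_ord0; apply/matrixP => i j; rewrite !ord1 mxE.
  by have /matrixP/(_ 0 0) := sB; rewrite !mxE; lra.
rewrite ltnS => nk sB.
have [t [c [d [t0 [cc dd cd] Bd Bc tmax]]]] := skew_top_pair B sB.
have [//|V [oV Vc Vd]] := orth_extend2 (0 : 'I_n.+2) 1 c d _ cc dd cd.
have oV' : V *m V^T = 1%:M by apply: mulmx1C.
pose B1 : 'M[R]_n.+2 := V^T *m B *m V.
have BE : B = V *m B1 *m V^T.
  by rewrite /B1 !mulmxA oV' mul1mx -mulmxA oV' mulmx1.
have sB1 : skew_mx B1.
  by rewrite /skew_mx !trmx_mul trmxK sB mulNmx mulmxN mulmxA.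
have B10 : B1 *m delta_mx 0 0 = - t *: delta_mx 1 0 :> 'cV_n.+2.
  by rewrite /B1 -!mulmxA Vc Bc -scalemxAr -Vd mulmxA oV mul1mx.
have B11 : B1 *m delta_mx 1 0 = t *: delta_mx 0 0 :> 'cV_n.+2.
  by rewrite /B1 -!mulmxA Vd Bd -scalemxAr -Vc mulmxA oV mul1mx.
clearbody B1.
pose B' := @drsubmx R 2 n 2 n B1.
have B1E : B1 = (block_mx (t *: (delta_mx 0 1 - delta_mx 1 0)) 0 0 B' : 'M[R]_(2 + n)).
  have l0 : lshift n (0 : 'I_2) = 0 by apply: val_inj.
  have l1 : lshift n (1 : 'I_2) = 1 by apply: val_inj.
  have e0 (i : 'I_(2 + n)) : B1 i (lshift n (0 : 'I_2)) = - t * (i == 1 :> nat)%:R.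
    by rewrite l0; have /colP/(_ i) := B10; rewrite -colE !mxE andbT.
  have e1 (i : 'I_(2 + n)) : B1 i (lshift n (1 : 'I_2)) = t * (i == 0 :> nat)%:R.
    by rewrite l1; have /colP/(_ i) := B11; rewrite -colE !mxE andbT.
  have sk i j : B1 i j = - B1 j i.
    by have /matrixP/(_ j i) := sB1; rewrite !mxE.
  have two (i : 'I_2) : i = 0 \/ i = 1.
    by case: i => [[|[|i]] hi] //; [left|right]; apply: val_inj.
  (* The first two columns are known from the images of the first two basis vectors; skew-symmetry
     then gives the upper right block. *)
  have lc (i : 'I_(2 + n)) (j : 'I_2) : B1 i (lshift n j) =
      (block_mx (t *: (delta_mx 0 1 - delta_mx 1 0)) 0 0 B' : 'M[R]_(2 + n)) i (lshift n j).
    case: (split_ordP i) => i' ->; last first.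
      rewrite block_mxEdl mxE.
      by case: (two j) => ->; rewrite ?e0 ?e1 /= mulr0.
    rewrite block_mxEul !mxE.
    case: (two j) => ->; case: (two i') => ->; rewrite ?e0 ?e1 /=; lra.
  apply/matrixP => i j.
  case: (@split_ordP 2 n j) => j' ->; first exact: lc.
  case: (@split_ordP 2 n i) => i' ->; last by rewrite (@block_mxEdr _ 2 n 2 n) /B' !mxE.
  by rewrite sk lc block_mxEdl (@block_mxEur _ 2 n 2 n) !mxE oppr0.
have sB' : skew_mx B'.
  apply/matrixP => i j; rewrite !mxE.
  by have /matrixP/(_ (rshift 2 i) (rshift 2 j)) := sB1; rewrite !mxE.
have tmax' v : dot (B' *m v) (B' *m v) <= t ^+ 2 * dot v v.
  have cm (w : 'cV[R]_n) : dot (col_mx (0 : 'cV[R]_2) w) (col_mx 0 w) = dot w w.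
    by rewrite /dot tr_col_mx mul_row_col mulmx0 add0r.
  have := tmax (V *m col_mx (0 : 'cV[R]_2) v).
  rewrite BE -!mulmxA (mulmxA V^T) oV mul1mx !(dot_orth oV) cm.
  by rewrite B1E (@mul_block_col _ 2 n 2 n) !mulmx0 !mul0mx !add0r cm.
have [s' [szs' srt' ge0' [U' oU' B'E]]] := IH n B' (ltnW nk) sB'.
(* The norm bound by [t] is inherited by [B']. Applied to a unit vector that [B'] maps to a vector
   of norm [a], the head of [s'], it yields a <= t. *)
have ts' : path >=%R t s'.
  case: (s') szs' srt' ge0' B'E => //= a l szl -> /andP[a0 _] B'E; rewrite andbT.
  have n2 : (0 < n./2)%N by rewrite -szl.
  have := tmax' (col (pair2 (Ordinal n2)) U').
  rewrite {1 2}B'E -/(pair_sum _ _) !pair_sum_pair2 // !dotZl !dotZr.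
  rewrite !(dot_col_orth _ _ oU') !eqxx !mulr1 /= -expr2.
  by rewrite ler_pXn2r ?nnegrE.
pose W : 'M[R]_(2 + n) := block_mx 1%:M 0 0 U'.
have oW : W^T *m W = 1%:M.
  rewrite /W tr_block_mx mulmx_block !trmx0 !mulmx0 !mul0mx !addr0 !add0r trmx1.
  by rewrite mul1mx oU' -scalar_mx_block.
exists (t :: s'); split => //=.
- by rewrite szs'.
- by rewrite t0.
exists (V *m W).
  by rewrite trmx_mul mulmxA -(mulmxA W^T) oV mulmx1.
rewrite [RHS](pair_sum_conj (t :: s') V W) [pair_sum _ _]pair_sum_block {1}BE B1E.
by rewrite {1}B'E.
Qed.

End Dot.

(** * Skew singular values *)

Section SingularValues.
Context {R : realType}.

(** The pairs are disjoint and cover every index except the last one when [n] is odd. *)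
Lemma sum_pair_le {n} (f : 'I_n -> R) : (forall j, 0 <= f j) ->
  \sum_(i < n./2) (f (pair1 i) + f (pair2 i)) <= \sum_j f j.
Proof.
have [k] := ubnP n; elim: k => // k IH in n f *; case: n f => [|[|n]] f.
- by move=> _ _; rewrite !big_ord0.
- by move=> _ f0; rewrite big_ord0 sumr_ge0.
rewrite ltnS => nk f0; rewrite [leLHS]big_ord_recl 2!big_ord_recl addrA.
apply: lerD.
  rewrite (_ : pair1 _ = ord0); last exact: val_inj.
  by rewrite (_ : pair2 _ = lift ord0 ord0) //; exact: val_inj.
apply: le_trans (IH n (fun j => f (lift ord0 (lift ord0 j))) (ltnW nk) _) => //.
rewrite le_eqVlt; apply/orP; left; apply/eqP/eq_bigr => i _.
by congr (f _ + f _); exact: val_inj.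
Qed.

Variables (n : nat) (B : 'M[R]_n) (s : seq R).
Hypothesis Bs : is_skew_singular_values B s.

Lemma sv_ge0 i : 0 <= s`_i.
Proof.
have [_ _ /all_nthP s0 _] := Bs.
(* Past the end of [s], the entry read is the default 0. *)
by have [/s0|/(nth_default 0)->] := ltnP i (size s); first exact.
Qed.

Lemma sv_le i j : (i <= j)%N -> s`_j <= s`_i.
Proof.
move=> ij; have [_ srt _ _] := Bs.
have [js|sj] := ltnP j (size s); last by rewrite nth_default // sv_ge0.
by apply: (sorted_leq_nth ge_trans ge_refl) => //; rewrite inE ?(leq_ltn_trans ij).
Qed.

Lemma skew_sv_skew : skew_mx B.
Proof.
have [_ _ _ [U _ ->]] := Bs.
rewrite /skew_mx linear_sum /= -sumrN; apply: eq_bigr => i _.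
by rewrite linearZ /= linearB /= !trmx_mul !trmxK -scalerN opprB.
Qed.

(** In the coordinates x of c and y of d along the columns of [U], each pair contributes s_i (x1 y2
    - x2 y1), at most s_0 / 2 times the sum of the four squares. By Parseval, all the squares add up
    to 2. *)
Lemma skew_bilinear_le c d : dot c c = 1 -> dot d d = 1 -> dot c (B *m d) <= s`_0.
Proof.
move=> cc dd; have [_ _ _ [U oU BE]] := Bs.
have oU' : U^T^T *m U^T = 1%:M by rewrite trmxK; apply: mulmx1C.
have sumsq v : dot v v = 1 -> \sum_j dot (col j U) v ^+ 2 = 1.
  move=> vv; rewrite -vv -(dot_orth oU') dotE; apply: eq_bigr => j _.
  by rewrite colE dot_mull dot_delta expr2.
rewrite [B]BE -/(pair_sum s U) pair_sum_mul dot_sumr.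
apply: (@le_trans _ _ (s`_0 / 2 *
    (\sum_j (dot (col j U) c ^+ 2 + dot (col j U) d ^+ 2)))); last first.
  by rewrite big_split /= !sumsq //; lra.
have s0 := sv_ge0 0.
apply: le_trans (ler_wpM2l _ (sum_pair_le _ _)); last first.
- by move=> j; rewrite addr_ge0 // sqr_ge0.
- by rewrite divr_ge0.
rewrite mulr_sumr; apply: ler_sum => i _.
rewrite /= dotZr dotDr dotNr !dotZr !(dotC c).
set x1 := dot _ c; set y2 := dot _ d; set x2 := dot _ c; set y1 := dot _ d.
have si := sv_ge0 i; have si0 : s`_i <= s`_0 by apply: sv_le.
pose z := (x1 ^+ 2 + y1 ^+ 2 + (x2 ^+ 2 + y2 ^+ 2)) / 2.
have z0 : 0 <= z by rewrite divr_ge0 ?addr_ge0 ?sqr_ge0.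
apply: (@le_trans _ _ (s`_i * z)); last first.
  by have := ler_wpM2r z0 si0; rewrite /z; lra.
apply: ler_wpM2l => //; rewrite /z -subr_ge0.
have := addr_ge0 (sqr_ge0 (y2 - x1)) (sqr_ge0 (y1 + x2)); rewrite !sqrrD sqrrN; lra.
Qed.

(** As B^T B = - B^2, each pair gives s_i^2 times the projector onto its plane, which has trace
    2. *)
Lemma tr_skew_sv : \tr (B^T *m B) = 2 * \sum_(i < n./2) s`_i ^+ 2.
Proof.
have [_ _ _ [U oU BE]] := Bs.
rewrite skew_sv_skew {2}BE mulNmx mulmx_sumr -sumrN raddf_sum /= mulr_sumr.
apply: eq_bigr => i _.
rewrite -scalemxAr mulmxBr !mulmxA [B]BE -/(pair_sum s U).
rewrite pair_sum_pair1 // pair_sum_pair2 // -!scalemxAl raddfN /= mxtraceZ.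
rewrite raddfB /= !mxtraceZ !mxtrace_outer !(dot_col_orth _ _ oU) !eqxx.
by rewrite /=; ring.
Qed.

Lemma sv0_gt0 : B != 0 -> 0 < s`_0.
Proof.
move=> B0; rewrite lt_def sv_ge0 andbT; apply: contra B0 => /eqP s0.
have [_ _ _ [U _ ->]] := Bs; apply/eqP/big1 => i _.
suff -> : s`_i = 0 by rewrite scale0r.
by apply/le_anti; rewrite sv_ge0 andbT (le_trans (sv_le 0 i _)) ?s0.
Qed.

Lemma sv0_sq_le : s`_0 ^+ 2 <= \sum_(i < n./2) s`_i ^+ 2.
Proof.
have [szs _ _ _] := Bs.
have [n0|n0] := posnP n./2.
  by rewrite n0 big_ord0 nth_default ?szs ?n0 // expr0n.
by rewrite (bigD1 (Ordinal n0)) //= lerDl; apply: sumr_ge0 => i _; rewrite sqr_ge0.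
Qed.

Variable e : 'cV[R]_n.
Hypothesis Be : B *m e = 0.

(** When s_i is nonzero, both columns lie in the range of [B], and the range of a skew-symmetric
    matrix is orthogonal to its kernel. *)
Lemma ker_dot_pair U (i : 'I_n./2) : U^T *m U = 1%:M -> B = pair_sum s U -> s`_i != 0 ->
  dot e (col (pair1 i) U) = 0 /\ dot e (col (pair2 i) U) = 0.
Proof.
move=> oU BE si0.
have eB v : dot e (B *m v) = 0.
  by rewrite dot_skew ?Be; [rewrite -(scale0r 0) dotZr mul0r oppr0|exact: skew_sv_skew].
split; apply: (mulfI si0); rewrite mulr0.
- by rewrite -dotZr -pair_sum_pair2 // -BE eB.
- by apply: oppr_inj; rewrite oppr0 -mulNr -dotZr -pair_sum_pair1 // -BE eB.
Qed.

(** This reconciles the bounds [(n-1)/2] and [n/2], which differ only for even [n]. In that case the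
    last singular value is 0: otherwise all are positive, [e] is orthogonal to every column of [U],
    and so e = 0. *)
Lemma sum_sv_ker : e != 0 ->
  \sum_(i < n.-1./2) s`_i ^+ 2 = \sum_(i < n./2) s`_i ^+ 2.
Proof.
move=> e0; have [_ _ _ [U oU BE]] := Bs.
have n0 : (0 < n)%N.
  by case: (n) e e0 => // e'; rewrite [e']flatmx0 eqxx.
have [nodd|neven] := boolP (odd n).
  suff -> : n.-1./2 = n./2 by [].
  by case: (n) n0 nodd => //= k _ kev; rewrite uphalf_half (negbTE kev).
have nE : n = n./2.*2 by rewrite even_halfK.
have k0 : (0 < n./2)%N by rewrite -double_gt0 -nE.
have -> : n.-1./2 = n./2.-1.
  by rewrite {1}nE -{1}(prednK k0) doubleS /= uphalf_double.
suff sl : s`_(n./2.-1) = 0.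
  move: sl; case: (n./2) k0 => //= k _ sk.
  by rewrite big_ord_recr /= sk expr0n /= addr0.
apply/eqP; apply: contraNT e0 => sl0.
have spos (i : 'I_n./2) : s`_i != 0.
  have sl : 0 < s`_n./2.-1 by rewrite lt_def sl0 sv_ge0.
  by rewrite gt_eqF // (lt_le_trans sl) // sv_le // -ltnS prednK.
have eU j : dot e (col j U) = 0.
  have jn : (j./2 < n./2)%N by rewrite ltn_half_double -nE.
  have [e1 e2] := ker_dot_pair _ (Ordinal jn) oU BE (spos _).
  have [jodd|jeven] := boolP (odd j).
    rewrite (_ : j = pair2 (Ordinal jn)) //; apply: val_inj => /=.
    by rewrite -{1}(odd_double_half j) jodd.
  rewrite (_ : j = pair1 (Ordinal jn)) //; apply: val_inj => /=.
  by rewrite even_halfK.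
have oU' : U *m U^T = 1%:M by apply: mulmx1C.
rewrite -[e]mul1mx -oU' -mulmxA (_ : U^T *m e = 0) ?mulmx0 //.
apply/colP => j; have -> : (U^T *m e) j 0 = dot e (col j U).
  by rewrite dotC dotE mxE; apply: eq_bigr => i _; rewrite !mxE.
by rewrite eU mxE.
Qed.

End SingularValues.

(** * Residual sum of squares *)

Section ResidualSumOfSquares.
Context {R : realType} {m : nat}.
Implicit Types (y : 'M[R]_m) (p : params R m).

Definition rss y p : R :=
  \sum_(ij : 'I_m * 'I_m | (ij.1 < ij.2)%N) (y ij.1 ij.2 - mu p ij.1 ij.2) ^+ 2.

Lemma dsumD (F G : 'I_m -> 'I_m -> R) :
  \sum_i \sum_j (F i j + G i j) = \sum_i \sum_j F i j + \sum_i \sum_j G i j.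
Proof. by under eq_bigr do rewrite big_split; rewrite big_split. Qed.

Lemma dsumZ a (F : 'I_m -> 'I_m -> R) :
  \sum_i \sum_j (a * F i j) = a * \sum_i \sum_j F i j.
Proof. by rewrite mulr_sumr; apply: eq_bigr => i _; rewrite mulr_sumr. Qed.

Lemma dsumM (f g : 'I_m -> R) :
  \sum_i \sum_j (f i * g j) = (\sum_i f i) * (\sum_j g j).
Proof. by rewrite mulr_suml; apply: eq_bigr => i _; rewrite mulr_sumr. Qed.

(** Sums over all i and j can be factored into single sums, unlike sums over i < j. *)
Lemma dsum_sym (F : 'I_m -> 'I_m -> R) :
  (forall i j, F i j = F j i) -> (forall i, F i i = 0) ->
  \sum_i \sum_j F i j = 2 * \sum_(ij : 'I_m * 'I_m | (ij.1 < ij.2)%N) F ij.1 ij.2.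
Proof.
move=> Fsym F0; rewrite pair_big /= (bigID (fun ij : 'I_m * 'I_m => (ij.1 < ij.2)%N)) /=.
rewrite mulr2n mulrDl mul1r; congr (_ + _).
rewrite (bigID (fun ij : 'I_m * 'I_m => (ij.2 < ij.1)%N)) /= [X in _ + X]big1 ?addr0.
  rewrite (reindex_inj (h := fun ij : 'I_m * 'I_m => (ij.2, ij.1))) /=; last first.
    by move=> [a b] [c d] [-> ->].
  apply: eq_big => [ij|ij _]; last exact: Fsym.
  by rewrite -leqNgt andb_idl // => /ltnW.
move=> [i j] /=; rewrite -!leqNgt => /andP[ji ij].
by rewrite (_ : i = j) //; apply/val_inj/anti_leq/andP.
Qed.

Lemma skew_entry y i j : skew_mx y -> y j i = - y i j.
Proof. by move=> sy; have /matrixP/(_ i j) := sy; rewrite !mxE. Qed.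

Lemma skew_diag y i : skew_mx y -> y i i = 0.
Proof. by move=> /(skew_entry y i i); lra. Qed.

Lemma sum_alpha_hat y : skew_mx y -> \sum_i alpha_hat y i = 0.
Proof.
move=> sy; rewrite -mulr_suml (_ : \sum_i \sum_j y i j = 0) ?mul0r //.
suff : \sum_i \sum_j y i j = - \sum_i \sum_j y i j by lra.
rewrite {1}exchange_big -sumrN; apply: eq_bigr => i _.
by rewrite -sumrN; apply: eq_bigr => j _; rewrite skew_entry.
Qed.

Lemma skew_Gamma_hat y : skew_mx y -> skew_mx (Gamma_hat y).
Proof.
move=> sy; apply/matrixP => i j; rewrite !mxE (skew_entry y) //; ring.
Qed.

Lemma Gamma_hat_row y i : skew_mx y -> \sum_j Gamma_hat y i j = 0.
Proof.
move=> sy; have m0 : m%:R != 0 :> R.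
  by rewrite pnatr_eq0 -lt0n (leq_ltn_trans _ (ltn_ord i)).
under eq_bigr do rewrite mxE opprB addrA.
rewrite sumrB big_split /= sum_alpha_hat // addr0 sumr_const card_ord.
by rewrite -(mulr_natr (alpha_hat y i)) /alpha_hat mulfVK // subrr.
Qed.

Lemma Gamma_hat_col y j : skew_mx y -> \sum_i Gamma_hat y i j = 0.
Proof.
move=> sy; transitivity (- \sum_i Gamma_hat y j i).
  rewrite -sumrN; apply: eq_bigr => i _; rewrite skew_entry //; exact: skew_Gamma_hat.
by rewrite Gamma_hat_row // oppr0.
Qed.

Lemma Gamma_hat_ker y : skew_mx y -> Gamma_hat y *m const_mx 1 = 0 :> 'cV_m.
Proof.
move=> sy; apply/colP => i; rewrite [RHS]mxE -(Gamma_hat_row y i) // mxE.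
by apply: eq_bigr => j _; rewrite [const_mx _ _ _]mxE mulr1.
Qed.

Lemma rss_Gamma_hat y p : skew_mx y -> param_space p ->
  rss y p = \tr ((Gamma_hat y)^T *m Gamma_hat y) / 2
    - 2 * lam p * dot (\col_i cvec p i) (Gamma_hat y *m \col_i dvec p i)
    + lam p ^+ 2
    + (\sum_i \sum_j ((alpha_hat y i - alpha p i) - (alpha_hat y j - alpha p j)) ^+ 2) / 2.
Proof.
move=> sy [[_ _ a0] [c1 d1 c0 d0 cd0]].
set G := Gamma_hat y; set c := cvec p in c1 c0 cd0 *; set d := dvec p in d1 d0 cd0 *.
pose a i := alpha_hat y i - alpha p i.
have suma : \sum_i a i = 0 by rewrite sumrB sum_alpha_hat // a0 subrr.
have rss2 : 2 * rss y p = \sum_i \sum_j (y i j - mu p i j) ^+ 2.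
  rewrite [RHS]dsum_sym // => [i j|i]; rewrite /mu.
    by rewrite [y j i]skew_entry //; ring.
  by rewrite skew_diag //; ring.
have trG : \tr (G^T *m G) = \sum_i \sum_j G i j ^+ 2.
  rewrite exchange_big; apply: eq_bigr => i _; rewrite mxE.
  by apply: eq_bigr => j _; rewrite mxE expr2.
have dotG (u v : 'I_m -> R) : dot (\col_i u i) (G *m \col_i v i) =
    \sum_i \sum_j u i * (G i j * v j).
  rewrite dotE; apply: eq_bigr => i _.
  rewrite [(\col_ _ _) _ _]mxE [(G *m _) _ _]mxE mulr_sumr.
  by apply: eq_bigr => j _; rewrite [(\col_ _ _) _ _]mxE.
have Gdc : \sum_i \sum_j d i * (G i j * c j) = - \sum_i \sum_j c i * (G i j * d j).
  by rewrite -!dotG; exact/dot_skew/skew_Gamma_hat.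
have Ga : \sum_i \sum_j G i j * a i = 0.
  by apply: big1 => i _; rewrite -mulr_suml Gamma_hat_row // mul0r.
have aG : \sum_i \sum_j G i j * a j = 0.
  by rewrite exchange_big; apply: big1 => i _; rewrite -mulr_suml Gamma_hat_col // mul0r.
suff : 2 * rss y p = \tr (G^T *m G) - 4 * lam p * dot (\col_i c i) (G *m \col_i d i)
    + 2 * lam p ^+ 2 + \sum_i \sum_j (a i - a j) ^+ 2 by lra.
rewrite rss2 trG dotG.
(* The residual is G_ij + (a_i - a_j) - lam (c_i d_j - d_i c_j). Its square is split so that each
   cross term either is covered by [Ga], [aG] or [Gdc], or factors into single sums fixed by the
   constraints on c and d. *)
transitivity (\sum_i \sum_j (G i j ^+ 2 + (a i - a j) ^+ 2 + 2 * (G i j * a i)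
  + (-2) * (G i j * a j) + (-2 * lam p) * (c i * (G i j * d j))
  + (2 * lam p) * (d i * (G i j * c j))
  + (- 2 * lam p) * ((a i * c i) * d j) + (2 * lam p) * ((a i * d i) * c j)
  + (2 * lam p) * (c i * (a j * d j)) + (- 2 * lam p) * (d i * (a j * c j))
  + lam p ^+ 2 * (c i ^+ 2 * d j ^+ 2) + (- 2 * lam p ^+ 2) * (c i * d i * (c j * d j))
  + lam p ^+ 2 * (d i ^+ 2 * c j ^+ 2))).
  apply: eq_bigr => i _; apply: eq_bigr => j _.
  by rewrite /mu mxE /a -/c -/d; ring.
rewrite !dsumD !dsumZ !dsumM Ga aG Gdc c0 d0 c1 d1 cd0; ring.
Qed.

End ResidualSumOfSquares.

(** * Gaussian likelihood *)

Section GaussianProfile.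
Context {R : realType}.
Implicit Types (n : nat) (v Q : R).

(** Likelihood of [n] independent normal observations with variance [v] and residual sum of squares
    [Q]. *)
Definition gauss_lik n v Q : R :=
  normal_peak (Num.sqrt v) ^+ n * expR (- Q / (v * 2)).

Lemma peakE v : 0 < v -> normal_peak (Num.sqrt v) ^+ 2 = (v * (pi *+ 2))^-1.
Proof.
move=> v0; rewrite exprVn sqr_sqrtr.
  by rewrite sqr_sqrtr ?ltW // -mulrnAr.
by rewrite mulrn_wge0 // mulr_ge0 ?sqr_ge0 ?pi_ge0.
Qed.

Lemma gauss_lik_ge0 n v Q : 0 <= gauss_lik n v Q.
Proof. by rewrite mulr_ge0 ?expR_ge0 ?exprn_ge0 ?normal_peak_ge0. Qed.

Lemma gauss_lik_anti n v Q Q' : 0 < v -> Q <= Q' -> gauss_lik n v Q' <= gauss_lik n v Q.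
Proof.
move=> v0 QQ; apply: ler_wpM2l; first by rewrite exprn_ge0 ?normal_peak_ge0.
by rewrite ler_expR ler_pM2r ?invr_gt0 ?mulr_gt0 // lerN2.
Qed.

(** Squaring removes the square root from the normalizing constant. *)
Lemma gauss_lik_sqr n v Q : 0 < v ->
  gauss_lik n v Q ^+ 2 = (v * (pi *+ 2)) ^- n * expR (- Q / v).
Proof.
move=> v0; rewrite exprMn -exprM mulnC exprM peakE // exprVn; congr (_ * _).
by rewrite -expRM_natl; congr expR; field; rewrite gt_eqF.
Qed.

(** The best variance is the mean squared residual. With r = (Q / n) / v, the squared inequality
    depends on r and n alone. *)
Lemma gauss_lik_max n v Q : (0 < n)%N -> 0 < v -> 0 < Q ->
  gauss_lik n v Q <= gauss_lik n (Q / n%:R) Q.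
Proof.
move=> n0 v0 Q0; set N : R := n%:R.
have NR : 0 < N by rewrite ltr0n.
have w0 : 0 < Q / N by rewrite divr_gt0.
rewrite -(@ler_pXn2r _ 2) ?nnegrE ?gauss_lik_ge0 // !gauss_lik_sqr //.
set r := Q / N / v.
have r0 : 0 < r by rewrite divr_gt0.
have pi2 : 0 < (pi : R) *+ 2 by rewrite mulrn_wgt0 // pi_gt0.
move: (pi *+ 2 : R) pi2 => c c0.
have -> : (v * c) ^- n = r ^+ n * (Q / N * c) ^- n.
  rewrite -exprVn -exprVn -exprMn; congr (_ ^+ _).
  by rewrite /r; clearbody N; field; rewrite !gt_eqF.
rewrite mulrC mulrA mulrC ler_pM2l ?invr_gt0 ?exprn_gt0 ?mulr_gt0 ?invr_gt0 //.
have -> : - Q / (Q / N) = - N by clearbody N; field; rewrite !gt_eqF.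
have -> : - Q / v = N * (- r) by rewrite /r; clearbody N; field; rewrite !gt_eqF.
have -> : - N = N * (-1) by rewrite mulrN1.
(* What remains is the n-th power of [r * expR (- r) <= expR (- 1)]. *)
rewrite !expRM_natl -exprMn ler_pXn2r ?nnegrE ?expR_ge0 //; last first.
  by rewrite mulr_ge0 ?expR_ge0 ?(ltW r0).
rewrite -(ler_pM2r (expR_gt0 r)) mulrAC -expRD addNr expR0 mul1r -expRD addrC.
(* The remaining r <= exp (r - 1) is the tangent bound 1 + x <= exp x at x = r - 1. *)
by have := expR_ge1Dx (r - 1); rewrite [1 + _]addrC subrK.
Qed.

(** At the best variance both exponential factors equal exp (- n / 2), so only the peaks,
    proportional to Q^(-1/2), remain. *)
Lemma gauss_lik_ratio n Q0 Q1 : (0 < n)%N -> 0 < Q0 -> 0 < Q1 ->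
  gauss_lik n (Q0 / n%:R) Q0 / gauss_lik n (Q1 / n%:R) Q1 =
  Num.sqrt (Q1 / Q0) ^+ n.
Proof.
move=> n0 Q00 Q10; set N : R := n%:R.
have NR : 0 < N by rewrite ltr0n.
have pi2 : 0 < (pi : R) *+ 2 by rewrite mulrn_wgt0 // pi_gt0.
have e Q : 0 < Q -> - Q / (Q / N * 2) = - N / 2.
  by move=> Qpos; clearbody N; field; rewrite !gt_eqF.
rewrite /gauss_lik !e // -mulf_div divff ?mulr1 ?gt_eqF ?expR_gt0 //.
rewrite -expr_div_n; congr (_ ^+ _).
have pk Q : 0 < Q -> 0 < normal_peak (Num.sqrt (Q / N)).
  by move=> Qpos; rewrite normal_peak_gt0 // gt_eqF // sqrtr_gt0 divr_gt0.
apply/eqP; rewrite -(@eqrXn2 _ 2) ?sqrtr_ge0 ?divr_ge0 ?normal_peak_ge0 //.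
rewrite expr_div_n !peakE ?divr_gt0 // sqr_sqrtr ?divr_ge0 ?ltW //.
move: (pi *+ 2 : R) pi2 => c c0; clearbody N.
by apply/eqP; field; rewrite !gt_eqF.
Qed.

Lemma gauss_lik0_unbounded n (M : R) : (0 < n)%N ->
  exists2 v, 0 < v & M <= gauss_lik n v 0.
Proof.
move=> n0; have pi2 : 0 < (pi : R) *+ 2 by rewrite mulrn_wgt0 // pi_gt0.
(* The variance 1 / (2 pi A^2) gives the density peak height A; A >= 1 ensures A^n >= A >= M. *)
pose A := Num.max 1 M; have A1 : 1 <= A by rewrite le_max lexx.
have A0 : 0 < A by apply: lt_le_trans A1.
have v0 : 0 < (A ^+ 2 * (pi *+ 2))^-1 by rewrite invr_gt0 mulr_gt0 ?exprn_gt0.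
exists (A ^+ 2 * (pi *+ 2))^-1 => //.
rewrite /gauss_lik oppr0 mul0r expR0 mulr1.
have -> : normal_peak (Num.sqrt (A ^+ 2 * (pi *+ 2))^-1) = A.
  apply/eqP; rewrite -(@eqrXn2 _ 2) ?normal_peak_ge0 ?ltW // peakE //.
  move: (pi *+ 2 : R) pi2 => c c0; clearbody A.
  by apply/eqP; field; rewrite !gt_eqF.
apply: (@le_trans _ _ A); first by rewrite le_max lexx orbT.
by apply: ler_eXnr.
Qed.

End GaussianProfile.

(** The number of independent observations, as the cardinal that [prodr_const] produces. *)
Definition npairs (m : nat) : nat := #|[pred ij : 'I_m * 'I_m | (ij.1 < ij.2)%N]|.

Lemma npairs_gt0 {m} : (1 < m)%N -> (0 < npairs m)%N.
Proof.
move=> m1; apply/card_gt0P.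
by exists (Ordinal (ltnW m1), Ordinal m1); rewrite inE.
Qed.

Section Likelihood.
Context {R : realType} {m : nat}.

Lemma likelihood_rss (y : 'M[R]_m) (p : params R m) : 0 < sigma2 p ->
  likelihood y p = gauss_lik (npairs m) (sigma2 p) (rss y p).
Proof.
move=> v0; rewrite /likelihood pair_big_dep /=.
have q0 : Num.sqrt (sigma2 p) != 0 by rewrite gt_eqF // sqrtr_gt0.
under eq_bigr do rewrite normal_pdfE //.
rewrite big_split /= prodr_const; congr (_ * _).
rewrite /normal_fun -expR_sum; congr expR.
rewrite /rss mulNr mulr_suml -sumrN; apply: eq_bigr => ij _.
by rewrite sqr_sqrtr ?ltW // mulNr mulr_natr.
Qed.

Variables (y : 'M[R]_m) (P : set (params R m)) (Q : R).
Hypothesis N0 : (0 < npairs m)%N.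
Hypothesis Ppos : forall p, P p -> 0 < sigma2 p.
Hypothesis Pattained : forall v, 0 < v ->
  exists p, [/\ P p, sigma2 p = v & rss y p = Q].

(** [P] stands for the null or the full parameter space and [Q] for its least residual sum of
    squares. As [Q] is attained at every variance, the variance can be optimized separately. *)
Lemma sup_likelihood_fin : (forall p, P p -> Q <= rss y p) -> 0 < Q ->
  sup_likelihood y P = (gauss_lik (npairs m) (Q / (npairs m)%:R) Q)%:E.
Proof.
move=> Pmin Q0; apply/eqP; rewrite eq_le; apply/andP; split.
  apply: ge_ereal_sup => _ [p Pp <-]; rewrite lee_fin likelihood_rss ?Ppos //.
  apply: le_trans (gauss_lik_anti _ _ _ _ (Ppos _ Pp) (Pmin _ Pp)) _.
  by apply: gauss_lik_max; rewrite ?Ppos.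
have w0 : 0 < Q / (npairs m)%:R by rewrite divr_gt0 // ltr0n.
have [p [Pp vp Qp]] := Pattained _ w0.
by apply: ereal_sup_ubound; exists p => //; rewrite likelihood_rss ?vp // Qp.
Qed.

Lemma sup_likelihood_pinfty : Q = 0 -> sup_likelihood y P = +oo%E.
Proof.
move=> Q0; apply/eqP; rewrite -leye_eq leNgt; apply/negP => supfin.
(* This also covers -oo, which [fine] sends to 0. *)
have supM : (sup_likelihood y P <= (fine (sup_likelihood y P) )%:E)%E.
  by move: supfin; case: sup_likelihood => //= _; exact: leNye.
have [v v0 Mv] := gauss_lik0_unbounded _ (fine (sup_likelihood y P) + 1) N0.
have [p [Pp vp Qp]] := Pattained _ v0.
have : ((likelihood y p)%:E <= sup_likelihood y P)%E.
  by apply: ereal_sup_ubound; exists p.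
move=> /le_trans /(_ supM); rewrite lee_fin likelihood_rss ?vp // Qp Q0; lra.
Qed.

End Likelihood.

(** * Likelihood ratio *)

Section LikelihoodRatio.
Context {R : realType} {m : nat}.
Hypothesis m3 : (3 <= m)%N.
Variables (y : 'M[R]_m) (s : seq R).
Hypotheses (sy : skew_mx y) (Gs : is_skew_singular_values (Gamma_hat y) s).
Hypothesis G0 : Gamma_hat y != 0.

Let S := \sum_(i < m./2) s`_i ^+ 2.

Lemma const1_neq0 : const_mx 1 != 0 :> 'cV[R]_m.
Proof.
apply/eqP => /colP/(_ (Ordinal (ltnW (ltnW m3)))).
by rewrite !mxE => /eqP; rewrite oner_eq0.
Qed.

Lemma rss_sv p : param_space p ->
  rss y p = S - 2 * lam p * dot (\col_i cvec p i) (Gamma_hat y *m \col_i dvec p i)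
    + lam p ^+ 2
    + (\sum_i \sum_j ((alpha_hat y i - alpha p i) - (alpha_hat y j - alpha p j)) ^+ 2) / 2.
Proof.
move=> pP; rewrite rss_Gamma_hat // (tr_skew_sv _ _ _ Gs); congr (_ - _ + _ + _).
by rewrite mulrC mulKf.
Qed.

Lemma rss_ge p : param_space p -> S - 2 * lam p * s`_0 + lam p ^+ 2 <= rss y p.
Proof.
move=> pP; rewrite rss_sv //; have [[_ l0 _] [c1 d1 _ _ _]] := pP.
apply: le_trans (_ : _ <= S - 2 * lam p * dot (\col_i cvec p i) (Gamma_hat y *m \col_i dvec p i)
    + lam p ^+ 2) _; last first.
  by rewrite lerDl divr_ge0 // sumr_ge0 // => i _; rewrite sumr_ge0 // => j _; rewrite sqr_ge0.
rewrite lerD2r lerD2l lerN2; apply: ler_wpM2l; first by rewrite mulr_ge0.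
apply: (skew_bilinear_le _ _ _ Gs).
- by rewrite dotE -[RHS]c1; apply: eq_bigr => i _; rewrite mxE expr2.
- by rewrite dotE -[RHS]d1; apply: eq_bigr => i _; rewrite mxE expr2.
Qed.

(** The witness takes [alpha_hat] and the leading pair of columns of [U]. These sum to zero because
    [Gamma_hat] kills the vector of ones and s_0 > 0. The values l = 0 and l = s_0 serve the null
    and the full model. *)
Lemma rss_attained v l : 0 < v -> 0 <= l ->
  exists p, [/\ param_space p, sigma2 p = v, lam p = l
    & rss y p = S - 2 * l * s`_0 + l ^+ 2].
Proof.
move=> v0 l0; have [_ _ _ [U oU GE]] := Gs.
have m2 : (0 < m./2)%N by rewrite half_gt0 ltnW.
pose i0 := Ordinal m2.
have s0 : s`_i0 != 0 by rewrite gt_eqF // (sv0_gt0 _ _ _ Gs).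
have [ec ed] := ker_dot_pair _ _ _ Gs _ (Gamma_hat_ker _ sy) _ i0 oU GE s0.
set c := col (pair1 i0) U in ec *; set d := col (pair2 i0) U in ed *.
pose p := Params v l (alpha_hat y) (fun i => c i 0) (fun i => d i 0).
have sum1 (u : 'cV[R]_m) : dot (const_mx 1) u = \sum_i u i 0.
  by rewrite dotE; apply: eq_bigr => i _; rewrite mxE mul1r.
have pP : param_space p.
  split; split => //=; rewrite -?sum1 ?sum_alpha_hat //.
  - rewrite -[RHS](_ : dot c c = 1); last by rewrite dot_col_orth // eqxx.
    by rewrite dotE; apply: eq_bigr => i _; rewrite expr2.
  - rewrite -[RHS](_ : dot d d = 1); last by rewrite dot_col_orth // eqxx.
    by rewrite dotE; apply: eq_bigr => i _; rewrite expr2.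
  - by rewrite -dotE dot_col_orth.
exists p; split=> //; rewrite rss_sv //= big1 => [|i _]; last first.
  by apply: big1 => j _; rewrite !subrr expr0n.
rewrite mul0r addr0; congr (_ - _ * _ + _).
have vE (u : 'cV[R]_m) : \col_i u i 0 = u by apply/colP => i; rewrite mxE.
rewrite !vE {1}GE -/(pair_sum s U) pair_sum_pair2 // dotZr dot_col_orth //.
by rewrite eqxx mulr1.
Qed.

Lemma sum_sv_sq_gt0 : 0 < S.
Proof. by rewrite (lt_le_trans _ (sv0_sq_le _ _ _ Gs)) // exprn_gt0 // (sv0_gt0 _ _ _ Gs). Qed.

Lemma likelihood_ratioE :
  likelihood_ratio y = Num.sqrt (1 - (s`_0 / Num.sqrt S) ^+ 2) ^+ npairs m.
Proof.
have N0 : (0 < npairs m)%N by apply: npairs_gt0; exact: ltnW.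
have s0 := sv0_gt0 _ _ _ Gs G0; have Sgt := sum_sv_sq_gt0.
have Tsq : 1 - (s`_0 / Num.sqrt S) ^+ 2 = (S - s`_0 ^+ 2) / S.
  by rewrite expr_div_n sqr_sqrtr ?ltW //; field; rewrite gt_eqF.
have null : sup_likelihood y (@null_space R m) = (gauss_lik (npairs m) (S / (npairs m)%:R) S)%:E.
  apply: sup_likelihood_fin => //.
  - by move=> p [[[]]].
  - move=> v v0; have [p [pP pv pl pr]] := rss_attained v 0 v0 (lexx 0).
    by exists p; split=> //; rewrite pr; ring.
  - move=> p [pP pl]; have := rss_ge p pP; rewrite /= in pl; rewrite pl; lra.
have full_att v : 0 < v -> exists p,
    [/\ @param_space R m p, sigma2 p = v & rss y p = S - s`_0 ^+ 2].
  move=> v0; have [p [pP pv pl pr]] := rss_attained v s`_0 v0 (ltW s0).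
  by exists p; split=> //; rewrite pr; ring.
have pos p : @param_space R m p -> 0 < sigma2 p by move=> [[]].
rewrite /likelihood_ratio Tsq.
(* A perfect fit makes the denominator infinite, so the ratio is 0 by convention; the right side is
   then a positive power of 0. *)
have [Q0|Q0] := eqVneq (S - s`_0 ^+ 2) 0.
  by rewrite (sup_likelihood_pinfty _ _ _ N0 full_att Q0) eqxx Q0 mul0r sqrtr0 expr0n
    gtn_eqF.
have Qpos : 0 < S - s`_0 ^+ 2.
  by rewrite lt_def Q0 subr_ge0 (sv0_sq_le _ _ _ Gs).
rewrite (sup_likelihood_fin _ _ _ N0 pos full_att) //=; last first.
  (* Completing the square: S - 2 l s_0 + l^2 = S - s_0^2 + (l - s_0)^2. *)
  move=> p pP; apply: le_trans (rss_ge p pP).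
  by have := sqr_ge0 (lam p - s`_0); lra.
by rewrite null /= gauss_lik_ratio.
Qed.

End LikelihoodRatio.

Theorem theorem3 (R : realType) (m : nat) (hm : (3 <= m)%N) :
  is_LRT_statistic (fun y : 'M[R]_m =>
    let s := skew_singular_values (Gamma_hat y) in
    s`_0 / Num.sqrt (\sum_(i < (m.-1)./2) s`_i ^+ 2))
  /\
  (forall y : 'M[R]_m, data_space y ->
    let s := skew_singular_values (Gamma_hat y) in
    s`_0 / Num.sqrt (\sum_(i < (m.-1)./2) s`_i ^+ 2)
    = s`_0 / Num.sqrt (\tr ((Gamma_hat y)^T *m Gamma_hat y) / 2)).
Proof.
have svP (y : 'M[R]_m) : data_space y ->
    is_skew_singular_values (Gamma_hat y) (skew_singular_values (Gamma_hat y)).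
  move=> [sy _]; have [s sP] := skew_singular_values_exists _ (skew_Gamma_hat _ sy).
  exact: (@xgetPex _ _ [set s | is_skew_singular_values (Gamma_hat y) s]) (ex_intro _ s sP).
have sumE (y : 'M[R]_m) : data_space y ->
    let s := skew_singular_values (Gamma_hat y) in
    \sum_(i < (m.-1)./2) s`_i ^+ 2 = \sum_(i < m./2) s`_i ^+ 2.
  move=> yD; have [sy _] := yD.
  by apply: (sum_sv_ker _ _ _ (svP y yD) _ (Gamma_hat_ker _ sy)); exact: const1_neq0.
split; last first.
  move=> y yD /=; rewrite sumE // (tr_skew_sv _ _ _ (svP y yD)).
  by rewrite [2 * _]mulrC mulfK.
(* This function is strictly decreasing on [0, 1], where the statistic takes its values. *)
exists (fun t => Num.sqrt (1 - t ^+ 2) ^+ npairs m); split.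
  move=> a b [y yD <-] [z zD <-] /=; rewrite !sumE //.
  set sy := skew_singular_values _; set sz := skew_singular_values _.
  set a' := _ / _; set b' := _ / _ => ab.
  have [_ Gy0] := yD; have [_ Gz0] := zD.
  have a0 : 0 <= a' by rewrite divr_ge0 ?sqrtr_ge0 // (sv_ge0 _ _ _ (svP y yD)).
  have b1 : b' ^+ 2 <= 1.
    rewrite expr_div_n sqr_sqrtr; last by apply: sumr_ge0 => i _; rewrite sqr_ge0.
    by rewrite ler_pdivrMr ?mul1r ?(sv0_sq_le _ _ _ (svP z zD)) // (sum_sv_sq_gt0 _ _ (svP z zD)).
  have ab2 : a' ^+ 2 < b' ^+ 2 by rewrite ltr_pXn2r ?nnegrE // (le_trans a0) ?ltW.
  rewrite ltr_pXn2r ?nnegrE ?sqrtr_ge0 //; last exact/npairs_gt0/ltnW.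
  (* [ltr_sqrt] asks for 1 - a'^2 > 0, which holds as a'^2 < b'^2 <= 1. *)
  by rewrite ltr_sqrt; lra.
move=> y yD; rewrite /= sumE //; have [sy Gy0] := yD.
exact: (likelihood_ratioE hm _ _ sy (svP y yD) Gy0).
Qed.
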